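(* The tree-version linear reduction algorithm is correct. That is: let $M$ be a proper non-clever tree monomial with loaded tree $T_M=(V,E,h,m)$, let $e=\{v_1,v_2\}$ be a multi-edge of $T_M$ (i.e. $m(e)\ge 2$) with corresponding cut $\{I,J\}$, and let $Q=\{i,j,k,l\}$ be a quadruple set with $i,j\in I$ and $k,l\in J$. Let $ST$ be the output of the algorithm on the input $(T_M,e,Q)$: $ST=\emptyset$ if both $v_1$ and $v_2$ have weight $0$, and otherwise $ST$ is the set of all loaded trees that can be obtained from $T_M$ with edge $e$ and quadruple set $Q$ by the vertex splitting process, either by splitting $v_1$ or by splitting $v_2$. Then the monomials of the loaded trees in $ST$ are exactly the monomials appearing on the right-hand side after one step of linear reduction on $M$ that reduces one occurrence of $\delta_{I,J}$ using the relation $\epsilon_{ij\mid kl}=\epsilon_{ik\mid jl}$, i.e. exactly the tree monomials of the form $$\frac{M}{\delta_{I,J}}\cdot\delta',\qquad \delta' \text{ a summand of } \epsilon_{ij\mid kl}-\delta_{I,J}.$$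
   Context: Let $N$ be a set with $|N|=n\ge3$. A cut is a bipartition $\{I,J\}$ of $N$ with $|I|,|J|\ge2$; $\delta_{I,J}=\delta_{J,I}$ is the class of the corresponding boundary divisor in the Chow ring of $\overline{\mathcal M}_{0,n}$. Monomials are treated as formal products of the symbols $\delta_{I,J}$. Two factors $\delta_{I_1,J_1},\delta_{I_2,J_2}$ fulfill Keel's quadratic relation (and then have product $0$) if $I_1\cap I_2$, $I_1\cap J_2$, $J_1\cap I_2$, $J_1\cap J_2$ are all nonempty. A tree monomial is a monomial no two factors of which fulfill Keel's quadratic relation. It is proper if it has degree $n-3$, and a proper tree monomial is non-clever if some factor occurs with exponent $>1$. For distinct $i,j,k,l\in N$, $\epsilon_{ij\mid kl}=\sum\delta_{A,B}$ over cuts $\{A,B\}$ with $i,j\in A$, $k,l\in B$; Keel's linear relation is $\epsilon_{ij\mid kl}=\epsilon_{ik\mid jl}=\epsilon_{il\mid kj}$. A linear reduction step replaces one occurrence of a factor $\delta_{I,J}$ with exponent $>1$ by $\epsilon_{ik\mid jl}-(\epsilon_{ij\mid kl}-\delta_{I,J})$ and deletes all terms that vanish by Keel's quadratic relation (in particular all those coming from $\epsilon_{ik\mid jl}$, since a factor $\delta_{I,J}$ remains); the remaining terms all carry a minus sign. A loaded tree with label set $N$ and $k$ fringes is a finite tree $(V,E)$ with $h:V\to2^N$ and $m:E\to\mathbb N^+$ such that the nonempty $h(v)$ partition $N$, $\sum_e m(e)=k$, and $\deg(v)+|h(v)|\ge3$ for all $v$ (each edge counts once in the degree, whatever its multiplicity).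 Each edge $e$ determines the cut formed by the label sets of the two components left after removing $e$; with $\Psi(e)$ the corresponding $\delta$, the monomial of the tree is $\prod_e\Psi(e)^{m(e)}$. This gives a one-to-one correspondence between loaded trees with $k\ge 1$ fringes and tree monomials of degree $k$; $T_M$ is the tree of $M$. The weight of a vertex $v$ is $\deg(v)+|h(v)|-3$. The branches of a vertex $v$ are the $\deg(v)$ parts, one for each edge at $v$ (that edge together with everything behind it), obtained by removing $v$ but not its incident edges. Vertex splitting with respect to $e=\{v_1,v_2\}$ and $Q=\{i,j,k,l\}$, at $v_1$ (where $v_1$ has nonzero weight and lies in the component of $T_M$ minus $e$ with label set $I$): replace $v_1$ by two vertices $v_1',v_1''$ joined by a new edge of multiplicity $1$. Distribute the labels of $h(v_1)$ among $v_1'$ and $v_1''$ so that the labels in $h(v_1)\cap\{i,j\}$ go to $v_1'$; if $v_1$ has no branches other than those containing a label in $\{i,j\}$ or the edge $e$, then $v_1''$ must receive at least one label. Attach the branches of $v_1$ containing $i$ or $j$ to $v_1'$; attach the branch containing $e$ (which contains $k$ and $l$) to $v_1''$, with the multiplicity of $e$ reduced by one; attach each other branch to either $v_1'$ or $v_1''$; if $v_1''$ received no label, then at least one branch other than the one containing $e$ must be attached to $v_1''$. Everything else is unchanged. Splitting at $v_2$ is defined in the same way with the roles of $(v_1,I,\{i,j\})$ and $(v_2,J,\{k,l\})$ interchanged.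
   Formalization: That every right-hand-side monomial comes from a tree in ST is stated only when no branch of v_1 contains both i and j and no branch of v_2 contains both k and l; otherwise the claimed equality is false. The reverse inclusion and the form (M/δ_{I,J})·δ' hold for every Q. *)

(* Defs.v *)
From mathcomp Require Import all_boot all_order all_algebra.
From mathcomp Require Import finmap.
From mathcomp Require Import monalg.

Set Implicit Arguments.
Unset Strict Implicit.
Unset Printing Implicit Defensive.

Import GRing.Theory.

Local Open Scope ring_scope.

(* monalg only declares this notation locally. *)
Notation "'U_(' c )" := (@ucm _ c) : monom_scope.

Section Monomials.
Variable N : finType.

(* The cut {I, J} is the unordered pair of its two parts, a set of sets; hence
   delta_{I,J} and delta_{J,I} are the same symbol. *)
Definition is_cut (P : {set {set N}}) : bool :=
  [&& partition P [set: N], #|P| == 2 & [forall A in P, (2 <= #|A|)%N]].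

Definition cut : predArgType := {P : {set {set N}} | is_cut P}.

(* The formal products of the symbols delta_c: M c is the exponent of delta_c
   in M. *)
Definition monomial : predArgType := {cmonom cut}.

Definition keel_quadratic (c d : cut) : bool :=
  [forall A in val c, [forall B in val d, A :&: B != set0]].

Definition tree_monomial (M : monomial) : bool :=
  [forall c, forall d,
     (0 < M c)%N ==> (0 < M d)%N ==> ~~ keel_quadratic c d].

Definition is_proper (M : monomial) : bool := mdeg M == (#|N| - 3)%N.

Definition is_nonclever (M : monomial) : bool := [exists c, (1 < M c)%N].

(* delta_c is a summand of epsilon_{ij|kl}. *)
Definition separates (c : cut) (i j k l : N) : bool :=
  [exists A, exists B, [&& val c == [set A; B],
     i \in A, j \in A, k \in B & l \in B]].

(* Formal integer combinations of monomials. *)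
Definition formal_sum : predArgType := {malg int[monomial]}.

Definition epsilon (i j k l : N) : formal_sum :=
  \sum_(c : cut | separates c i j k l) << U_(c)%M >>.

(* divcm is the division of monomials: it subtracts exponents. *)
Definition divide_delta (M : monomial) (c : cut) : monomial :=
  divcm M U_(c)%M.

Definition delete_keel (p : formal_sum) : formal_sum :=
  \sum_(P <- msupp p | tree_monomial P) << p@_P *g P >>.

Definition linear_reduction (M : monomial) (c : cut) (i j k l : N)
    : formal_sum :=
  delete_keel
    (<< divide_delta M c >> *
       (epsilon i k j l - (epsilon i j k l - << U_(c)%M >>))).

End Monomials.

Arguments monomial N : clear implicits.
Arguments cut N : clear implicits.

(* Edges are two-element sets of vertices; only the values of the multiplicity
   on edges are relevant. *)
Record ltree (N : finType) := LTree {
  vertex : finType;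
  edges : {set {set vertex}};
  labels : vertex -> {set N};
  mult : {set vertex} -> nat
}.

Section Trees.
Variables (N : finType) (T : ltree N).
Implicit Types (v w : vertex T) (e f : {set vertex T}).

Definition adj (E : {set {set vertex T}}) : rel (vertex T) :=
  fun v w => [set v; w] \in E.

Definition incident v : {set {set vertex T}} := [set f in edges T | v \in f].

Definition degree v : nat := #|incident v|.

Definition is_tree : Prop :=
  [/\ forall f, f \in edges T -> #|f| = 2,
      forall v w, connect (adj (edges T)) v w
    & forall p : seq (vertex T), ucycle (adj (edges T)) p -> (size p <= 2)%N].

Definition is_loaded : Prop :=
  [/\ is_tree,
      (forall v w, v != w -> [disjoint labels v & labels w])
        /\ \bigcup_(v : vertex T) labels v = [set: N],
      forall f, f \in edges T -> (0 < mult f)%N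
    & forall v, (3 <= degree v + #|labels v|)%N].

(* This is truncated subtraction; degree v + #|labels v| >= 3 in a loaded
   tree. *)
Definition weight v : nat := (degree v + #|labels v| - 3)%N.

(* The label set of the component of T minus e which contains v. *)
Definition side e v : {set N} :=
  \bigcup_(w | connect (adj (edges T :\ e)) v w) labels w.

Definition edge_cut e : {set {set N}} := [set side e v | v in e].

(* The default value 1 is never used when T is loaded: each edge of a loaded
   tree determines a cut. *)
Definition edge_delta e : monomial N :=
  if insub (edge_cut e) is Some c then U_(c)%M else mone.

Definition tree_product : monomial N :=
  \big[mmul/mone]_(e in edges T) expcmn (edge_delta e) (mult e).

(* A branch of v is given by its edge f at v; these are the labels behind f. *)
Definition branch_labels v f : {set N} := \bigcup_(w in f :\ v) side f w.

End Trees.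

Section Splitting.
Variables (N : finType) (T : ltree N).
Implicit Types (v w : vertex T) (e f : {set vertex T}).

(* No branch of v contains both a and b. For the quadruple set {i, j, k, l} of
   the edge {v1, v2}, if a branch of v1 with edge f contains both i and j, then
   the cut of f is a summand of epsilon_{ij|kl}, and replacing delta_{I,J} by
   its symbol gives a tree monomial which no vertex splitting produces. *)
Definition apart v (a b : N) : Prop :=
  forall f, f \in incident v ->
    ~~ ((a \in branch_labels v f) && (b \in branch_labels v f)).

(* The vertices of the tree after splitting v are Some w for w != v, together
   with v' = Some v and v'' = None. L is the set of labels given to v'', and F
   is the set of edges at v whose branches are attached to v''. *)
Definition reattach v (F : {set {set vertex T}}) f
    : {set option (vertex T)} :=
  if f \in F then None |: (Some @: (f :\ v)) else Some @: f.

Definition new_edge v : {set option (vertex T)} := [set Some v; None].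

(* odflt v identifies v' and v'' again, so that odflt v @: g is the edge of T
   from which g comes, unless g is the new edge. *)
Definition split_tree v e (L : {set N}) (F : {set {set vertex T}}) : ltree N :=
  {| vertex := option (vertex T);
     edges := new_edge v |: [set reattach v F f | f in edges T];
     labels := fun u => if u is Some w then
                          if w == v then labels v :\: L else labels w
                        else L;
     mult := fun g : {set option (vertex T)} =>
               if g == new_edge v then 1%N
               else let f := odflt v @: g in (mult f - (f == e))%N |}.

Definition split_admissible v e (a b : N) (L : {set N})
    (F : {set {set vertex T}}) : Prop :=
  [/\ weight v != 0%N,
      (L \subset labels v) /\ [disjoint L & [set a; b]],
      [/\ F \subset incident v, e \in F
        & forall f, f \in incident v ->
            (a \in branch_labels v f) || (b \in branch_labels v f) ->
            f \notin F],
      (forall f, f \in incident v ->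
         [|| f == e, a \in branch_labels v f | b \in branch_labels v f]) ->
      L != set0
    & L = set0 -> exists2 f, f \in F & f != e].

Definition vertex_splitting v e (a b : N) (T' : ltree N) : Prop :=
  exists L F,
    [/\ split_admissible v e a b L F, T' = split_tree v e L F & is_loaded T'].

End Splitting.

(* The output ST of the algorithm on the tree T, the edge {v1, v2} and the
   quadruple set {i, j, k, l}. *)
Definition reduction_output (N : finType) (T : ltree N) (v1 v2 : vertex T)
    (i j k l : N) (T' : ltree N) : Prop :=
  ~ (weight v1 = 0%N /\ weight v2 = 0%N) /\
  (vertex_splitting v1 [set v1; v2] i j T' \/
   vertex_splitting v2 [set v1; v2] k l T').

(* Main.v *)
Require Import Defs.
From mathcomp Require Import all_boot all_order all_algebra.
From mathcomp Require Import finmap.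
From mathcomp Require Import monalg.

Set Implicit Arguments.
Unset Strict Implicit.
Unset Printing Implicit Defensive.

Import GRing.Theory.
Local Open Scope ring_scope.

(** Contracting the new edge of a split tree gives back [T], so every old edge
    keeps its cut and the monomial becomes [M / delta_c * delta_d], with [d] the
    cut of the new edge; [d] is a summand of [epsilon_{ij|kl}] other than [c].
    Conversely, let [B] be the part of such a [d] containing [k] and [l], and
    assume that [M / delta_c * delta_d] is a tree monomial. Since [c] is still a
    factor, [B] properly contains [J] or is properly contained in it. In the
    first case, as [d] does not cross the cuts of the edges at [v1], each branch
    of [v1] lies in [B] or misses it, unless it contains both [i] and [j];
    giving [v1''] the labels and branches contained in [B] realizes [d]. The
    second case is the same at [v2]. In the reduction itself, the cuts
    separating [i, k] from [j, l] all cross [c], so they are deleted and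
    nothing cancels. *)

Lemma imset_pair (aT rT : finType) (h : aT -> rT) x y :
  h @: [set x; y] = [set h x; h y].
Proof. by rewrite imsetU1 imset_set1. Qed.

(** Paths are extended at their end, so the start stays fixed and an invariant is carried across one
    edge at a time. *)
Lemma connect_ind (V : finType) (r : rel V) (x : V) (P : V -> Prop) :
    P x -> (forall a b, connect r x a -> P a -> r a b -> P b) ->
  forall u, connect r x u -> P u.
Proof.
move=> Px Pstep u /connectP[p]; elim/last_ind: p u => [|p b IHp] u /=.
  by move=> _ ->.
rewrite rcons_path last_rcons => /andP[rp rb] ->.
by apply: (Pstep (last x p)) => //; [apply/connectP; exists p | apply: IHp].
Qed.

(** * Bridges and the two sides of an edge *)

Section Trees.
Variables (N : finType) (T : ltree N).
Implicit Types (v w x y z u : vertex T) (e f g : {set vertex T}).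
Implicit Types (E : {set {set vertex T}}).

Notation cut_connect f := (connect (adj (edges T :\ f))).

Lemma adj_sym E : symmetric (adj E).
Proof. by move=> v w; rewrite /adj setUC. Qed.

Lemma connect_adjC E : connect_sym (adj E).
Proof. exact/sym_connect_sym/adj_sym. Qed.

(** In a cycle of length at least 3, the rest of the cycle bypasses its first edge, which is then
    not a bridge. This is how a split tree is shown to be acyclic. *)
Lemma bridges_acyclic :
    (forall v w, [set v; w] \in edges T -> ~~ cut_connect [set v; w] v w) ->
  forall p : seq (vertex T), ucycle (adj (edges T)) p -> (size p <= 2)%N.
Proof.
move=> bridge [|x [|y [|z q]]] // /andP[/= /and3P[exy eyz zqx]].
rewrite !inE !negb_or => /and3P[/and3P[xDy xDz x_q] /andP[yDz y_q] _].
case/negP: (bridge x y exy); rewrite connect_adjC.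
apply/(@connect_trans _ _ z).
  rewrite /adj in eyz; apply/connect1; rewrite /adj !inE eyz andbT.
  apply/eqP => /setP/(_ z).
  by rewrite !inE eqxx orbT [z == x]eq_sym [z == y]eq_sym (negPf xDz) (negPf yDz).
apply/connectP; exists (rcons q x); last by rewrite last_rcons.
(* The way from [z] through [q] back to [x] never meets [y], so it cannot use the edge
   [[set x; y]]. *)
apply: (sub_in_path (P := [pred u | u != y])) zqx => [u w|]; last first.
  rewrite /= all_rcons /= eq_sym yDz xDy /=.
  by apply/allP => u uq /=; apply: contraNneq y_q => <-.
rewrite !inE /adj => uDy wDy Euw; rewrite !inE Euw andbT.
apply/eqP => /setP/(_ y); rewrite !inE eqxx orbT.
by rewrite [y == u]eq_sym [y == w]eq_sym (negPf uDy) (negPf wDy).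
Qed.

Section Tree.
Hypothesis treeT : is_tree T.

Lemma edge_pair f v : f \in edges T -> v \in f ->
  exists2 w, f = [set v; w] & w != v.
Proof.
case: treeT => card2 _ _ /card2/eqP/cards2P[a [b [aDb ->]]].
rewrite !inE => /orP[]/eqP->; first by exists b => //; rewrite eq_sym.
by exists a; rewrite ?[[set b; a]]setUC.
Qed.

Lemma edge_ends f : f \in edges T -> exists x y, f = [set x; y] /\ x != y.
Proof.
by case: treeT => card2 _ _ /card2/eqP/cards2P[x [y [xDy ->]]]; exists x, y.
Qed.

Lemma edge_neq x y : [set x; y] \in edges T -> x != y.
Proof.
by case: treeT => card2 _ _ /card2; apply: contra_eq_neq => ->; rewrite setUid cards1.
Qed.

(** A simple path from [x] to [y] avoiding their edge is closed by that edge to a cycle. Acyclicity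
    leaves at most one step, which could only be the removed edge. *)
Lemma tree_bridge x y : [set x; y] \in edges T -> ~~ cut_connect [set x; y] x y.
Proof.
move=> fE; have xDy := edge_neq fE; case: treeT => _ _ acyc.
apply/negP => /connectP[p ep yp]; case/shortenP: ep yp => q eq uq _ yq.
have sub : subrel (adj (edges T :\ [set x; y])) (adj (edges T)).
  by move=> u w; rewrite /adj !inE => /andP[].
have /acyc : ucycle (adj (edges T)) (x :: q).
  rewrite /ucycle uq andbT /= rcons_path (sub_path sub) //=.
  by rewrite -yq /adj setUC.
case: q eq yq uq => [|a [|//]] /=; first by move=> _ yx; rewrite yx eqxx in xDy.
by rewrite /adj andbT => xa ya; rewrite -ya !inE eqxx in xa.
Qed.

(** A path of [T] from [x] that crosses the removed edge lands on [x] or [y], so each vertex is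
    reached from one of them; reached from both, it would connect [x] to [y]. *)
Lemma cut_connectC x y u : [set x; y] \in edges T ->
  cut_connect [set x; y] y u = ~~ cut_connect [set x; y] x u.
Proof.
move=> fE; have nxy := tree_bridge fE; set c := cut_connect _ in nxy *.
have cS a b : c a b = c b a by apply: connect_adjC.
have cT a b d : c a b -> c b d -> c a d by apply: connect_trans.
have : c x u || c y u.
  case: treeT => _ conn _; move: u (conn x u).
  apply: connect_ind; first by rewrite /c connect0.
  move=> a b _ IH ab; have [abf|abf] := eqVneq [set a; b] [set x; y].
    have : b \in [set x; y] by rewrite -abf !inE eqxx orbT.
    by case/set2P=> ->; rewrite /c connect0 ?orbT.
  have cab : c a b by apply: connect1; rewrite /adj !inE abf.
  by case/orP: IH => /cT/(_ cab) ->; rewrite ?orbT.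
have [cxu _|//] := boolP (c x u); apply/negP => cyu.
by case/negP: nxy; rewrite (cT _ _ _ cxu) // cS.
Qed.

(* A path of T - g that misses an end of f also misses f itself. *)
Lemma cut_connect_sub f g x z u : f \in edges T -> f != g -> x \in f ->
  ~~ cut_connect g z x -> cut_connect g z u -> cut_connect f z u.
Proof.
move=> fE fDg xf nzx; move: u; apply: connect_ind => // a b za IH ab.
apply: (connect_trans IH); apply: connect1; move: ab.
rewrite /adj !inE => /andP[abg abE]; rewrite abE andbT.
apply: contraNneq nzx => abf; rewrite -abf in xf.
have ab : cut_connect g a b by apply: connect1; rewrite /adj !inE abg.
by case/set2P: xf => ->; rewrite // (connect_trans za).
Qed.

End Tree.

Section Loaded.
Hypothesis loadedT : is_loaded T.

Let treeT : is_tree T. Proof. by case: loadedT. Qed.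

Lemma label_vertex n : exists v, n \in labels v.
Proof.
case: loadedT => _ [_ cover] _ _.
by have := in_setT n; rewrite -cover => /bigcupP[v _]; exists v.
Qed.

Lemma label_vertex_uniq n v w : n \in labels v -> n \in labels w -> v = w.
Proof.
case: loadedT => _ [disj _] _ _ nv nw.
by apply/eqP; apply: contraTT nw => /disj/disjointFr->.
Qed.

(** Each label sits at exactly one vertex, so statements about label sets become statements about
    reachability. *)
Lemma mem_side e v u n : n \in labels u -> (n \in side e v) = cut_connect e v u.
Proof.
move=> nu; apply/bigcupP/idP => [[w vw nw]|vu]; last by exists u.
by rewrite (label_vertex_uniq nu nw).
Qed.

Lemma side_setC x y : [set x; y] \in edges T ->
  side [set x; y] y = ~: side [set x; y] x.
Proof.
move=> fE; apply/setP => n; have [u nu] := label_vertex n.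
by rewrite inE !(mem_side _ _ nu) cut_connectC.
Qed.

Lemma mem_branch v f u n : f \in incident v -> n \in labels u ->
  (n \in branch_labels v f) = ~~ cut_connect f v u.
Proof.
rewrite inE => /andP[fE vf] nu; have [w fvw wDv] := edge_pair treeT fE vf.
have -> : branch_labels v f = side f w.
  rewrite /branch_labels (_ : f :\ v = [set w]) ?big_set1 //.
  apply/setP => a; rewrite fvw !inE.
  by case: (eqVneq a v) => [->|] //=; rewrite [v == w]eq_sym (negPf wDv).
by rewrite (mem_side _ _ nu) fvw cut_connectC -?fvw.
Qed.

Lemma branch_side v f x : f \in edges T -> f = [set v; x] ->
  branch_labels v f = side f x.
Proof.
move=> fE fvx; apply/setP => n; have [u nu] := label_vertex n.
have fv : f \in incident v by rewrite inE fE fvx !inE eqxx.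
by rewrite (mem_branch fv nu) (mem_side _ _ nu) fvx cut_connectC -?fvx.
Qed.

(* A vertex with at most one label has a further edge, whose far side is
   smaller. *)
Lemma card_side f w : f \in edges T -> w \in f -> (2 <= #|side f w|)%N.
Proof.
(* Induction on the number of vertices in the component of [w], for all edges and ends at once. *)
move: {2}_.+1 (ltnSn #|[set u | cut_connect f w u]|) => m.
elim: m => // m IHm in f w * => sz fE wf.
have labels_side : labels w \subset side f w.
  by apply/subsetP => n nw; rewrite (mem_side _ _ nw) connect0.
have [lw|lw] := leqP 2 #|labels w|.
  exact: leq_trans lw (subset_leq_card labels_side).
case: loadedT => _ _ _ /(_ w) dw.
(* With at most one label, degree plus labels being at least 3 forces two edges, one of which is not
   [f]. *)
have /card_gt1P[g1 [g2 [g1w g2w g1Dg2]]] : (1 < #|incident w|)%N.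
  by move: dw; rewrite /degree; case: #|labels w| lw => [|[]] // _;
   rewrite ?addn0 ?addn1 // => /ltnW.
have [g gw gDf] : exists2 g, g \in incident w & f != g.
  have [fg1|] := eqVneq f g1; [exists g2 | exists g1] => //.
  by rewrite fg1.
move: (gw); rewrite inE => /andP[gE w_g]; have [z gwz zDw] := edge_pair treeT gE w_g.
have nzw : ~~ cut_connect g z w.
  by rewrite gwz setUC; apply: tree_bridge => //; rewrite setUC -gwz.
have sub u : cut_connect g z u -> cut_connect f w u.
  move/(cut_connect_sub fE gDf wf nzw); apply: connect_trans.
  by apply: connect1; rewrite /adj !inE -gwz eq_sym gDf.
apply: (@leq_trans #|side g z|).
  apply: IHm => //; last by rewrite gwz !inE eqxx orbT.
  rewrite -ltnS; apply: leq_trans sz; rewrite ltnS; apply: proper_card.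
  apply/properP; split; last by exists w; rewrite inE ?connect0.
  by apply/subsetP => u; rewrite !inE; apply: sub.
apply: subset_leq_card; apply/subsetP => n; have [u nu] := label_vertex n.
by rewrite !(mem_side _ _ nu); apply: sub.
Qed.

Lemma edge_cut_pair x y : [set x; y] \in edges T ->
  edge_cut [set x; y] = [set side [set x; y] x; ~: side [set x; y] x].
Proof. by move=> fE; rewrite /edge_cut imset_pair -side_setC. Qed.

End Loaded.
End Trees.

(** * Cuts as a set and its complement *)

Section Cuts.
Variable N : finType.
Implicit Types (A B : {set N}) (c d : cut N).

Lemma is_cut_setC A : (2 <= #|A|)%N -> (2 <= #|~: A|)%N -> is_cut [set A; ~: A].
Proof.
move=> cA cA'; have AD : A != ~: A.
  apply/eqP => /setP AA; case/card_gt0P: (ltnW cA) => n nA.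
  by have := AA n; rewrite inE nA.
apply/and3P; split; last first.
- by apply/forall_inP => B /set2P[]->.
- by rewrite cards2 AD.
apply/and3P; split.
- by rewrite /cover bigcup_setU !big_set1 setUCr.
- apply/trivIsetP => B C /set2P[]-> /set2P[]->; rewrite ?eqxx // => _.
    by rewrite disjoints_subset setCK.
  by rewrite disjoint_sym disjoints_subset setCK.
- by apply/set2P => -[] A0; move: cA cA'; rewrite -A0 cards0.
Qed.

Lemma cut_pair c A : A \in val c -> val c = [set A; ~: A].
Proof.
case: c => P /= /and3P[/and3P[/eqP cov triv _] /cards2P[A1 [A2 [D eP]]] _] AP.
have dual B : B \in P -> A != B -> B = ~: A.
  move=> BP ADB; apply/eqP; rewrite eqEsubset -disjoints_subset disjoint_sym.
  rewrite (trivIsetP triv) //=; apply/subsetP => n; rewrite inE => nA.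
  have : n \in cover P by rewrite cov inE.
  case/bigcupP => C CP nC; suff -> : B = C by [].
  have CDA : A != C by apply: contraNneq nA => ->.
  move: AP BP CP ADB CDA; rewrite eP.
  by do 3![case/set2P=> ->]; rewrite ?eqxx.
move: AP dual; rewrite eP => /set2P[]-> dual.
  by rewrite -(dual A2) // !inE eqxx ?orbT.
by rewrite setUC -(dual A1) // ?inE ?eqxx ?orbT // eq_sym.
Qed.

Lemma keel_quadraticN c d A B : A \in val c -> B \in val d -> [disjoint A & B] ->
  ~~ keel_quadratic c d.
Proof.
move=> Ac Bd; rewrite -setI_eq0 => AB; apply/negP.
by move=> /forall_inP/(_ A Ac)/forall_inP/(_ B Bd); rewrite AB.
Qed.

Lemma keel_quadraticxx c : ~~ keel_quadratic c c.
Proof.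
have /card_gt0P[A Ac] : (0 < #|val c|)%N.
  by case: c => P /= /and3P[_ /eqP-> _].
have Ac' : ~: A \in val c by rewrite (cut_pair Ac) !inE eqxx orbT.
by apply: keel_quadraticN Ac Ac' _; rewrite disjoints_subset setCK.
Qed.

(** The second part of a cut is the complement of the first, so a single set serves as witness. *)
Lemma separatesP c i j k l : reflect
  (exists A, [/\ val c = [set A; ~: A], i \in A, j \in A, k \notin A & l \notin A])
  (separates c i j k l).
Proof.
apply: (iffP existsP) => [[A /existsP[B /and5P[/eqP cAB iA jA kB lB]]]|].
  have Ac : A \in val c by rewrite cAB !inE eqxx.
  have BA : B = ~: A.
    have := cut_pair Ac; rewrite cAB => /setP/(_ B); rewrite !inE eqxx orbT.
    case: (eqVneq B A) => [BA _|_ /esym/eqP //].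
    case: c cAB {Ac} => P /= /and3P[_ + _] eP.
    by rewrite eP BA setUid cards1.
  by exists A; rewrite cAB; move: kB lB; rewrite BA !inE.
case=> A [cA iA jA kA lA]; exists A; apply/existsP; exists (~: A).
by rewrite cA eqxx iA jA !inE kA lA.
Qed.

End Cuts.

(** * The monomial of a loaded tree is a tree monomial *)

Section TreeMonomial.
Variables (N : finType) (T : ltree N).
Hypothesis loadedT : is_loaded T.
Let treeT : is_tree T. Proof. by case: loadedT. Qed.

Lemma edge_is_cut f : f \in edges T -> is_cut (edge_cut f).
Proof.
move=> fE; have [x [y [fxy xDy]]] := edge_ends treeT fE; rewrite fxy in fE *.
rewrite edge_cut_pair // is_cut_setC -?side_setC ?card_side //.
  by rewrite !inE eqxx.
by rewrite !inE eqxx orbT.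
Qed.

(** The bundled cut of an edge, which removes the default branch of [edge_delta]. *)
Definition edge_sym f (fE : f \in edges T) : cut N :=
  exist (fun P => is_cut P) _ (edge_is_cut fE).

Lemma edge_deltaE f (fE : f \in edges T) : edge_delta f = (U_(edge_sym fE))%M.
Proof. by rewrite /edge_delta (insubT _ (edge_is_cut fE)). Qed.

(** The edge [f] lies within one component of the tree minus [g]. The other side of [g] is untouched
    by removing [f], so it misses one side of [f]. *)
Lemma edges_noncrossing f g (fE : f \in edges T) (gE : g \in edges T) :
  ~~ keel_quadratic (edge_sym fE) (edge_sym gE).
Proof.
have [fg|fDg] := eqVneq f g.
  by rewrite (_ : edge_sym fE = edge_sym gE) ?keel_quadraticxx //;
     apply: val_inj; rewrite /= fg.
have [x [y [fxy xDy]]] := edge_ends treeT fE.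
have [z [w [gzw zDw]]] := edge_ends treeT gE.
(* Name the ends of [g] so that [z'] is on the side away from [x]. *)
have {zDw} [z' [w' [gzw' nzx]]] : exists z' w',
    g = [set z'; w'] /\ ~~ connect (adj (edges T :\ g)) z' x.
  have [zx|nzx] := boolP (connect (adj (edges T :\ g)) z x); last by exists z, w.
  exists w, z; split; first by rewrite setUC.
  by rewrite gzw cut_connectC -?gzw ?zx.
have far u : connect (adj (edges T :\ g)) z' u -> connect (adj (edges T :\ f)) z' u.
  by apply: cut_connect_sub nzx; rewrite // fxy !inE eqxx.
(* Then [y'] is the end of [f] whose side does not contain [z']. *)
have [y' y'f nyz] : exists2 y', y' \in f & ~~ connect (adj (edges T :\ f)) y' z'.
  have [xz|nxz] := boolP (connect (adj (edges T :\ f)) x z'); last first.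
    by exists x => //; rewrite fxy !inE eqxx.
  by exists y; rewrite ?fxy ?cut_connectC -?fxy ?xz ?fE // fxy !inE eqxx orbT.
apply: (@keel_quadraticN _ _ _ (side f y') (side g z')).
- exact: imset_f.
- by apply: imset_f; rewrite gzw' !inE eqxx.
- rewrite -setI_eq0; apply/set0Pn => -[n]; rewrite inE.
  have [u nu] := label_vertex loadedT n.
  rewrite !(mem_side loadedT _ _ nu) => /andP[yu /far zu].
  case/negP: nyz; apply: connect_trans yu _.
  by rewrite connect_adjC.
Qed.

Lemma big_monomialE (I : Type) (r : seq I) (P : pred I) (F : I -> monomial N) d :
  (\big[mmul/mone]_(x <- r | P x) F x) d = (\sum_(x <- r | P x) F x d)%N.
Proof. exact: (big_morph (fun m : monomial N => m d) (cmM d) (cm1 d)). Qed.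

Lemma expcmnE (m : monomial N) n d : expcmn m n d = (n * m d)%N.
Proof.
rewrite /expcmn; elim: n => [|n IH]; first by rewrite onecmE.
by case: n IH => [|n] IH; rewrite ?mul1n // mulSn -IH !iteropS iterS mulcmE.
Qed.

Lemma tree_productE d :
  tree_product T d = (\sum_(f in edges T) mult f * edge_delta f d)%N.
Proof. by rewrite /tree_product big_monomialE; apply: eq_bigr => f _; apply: expcmnE. Qed.

Lemma tree_product_gt0 d : (0 < tree_product T d)%N ->
  exists f (fE : f \in edges T), d = edge_sym fE.
Proof.
rewrite tree_productE lt0n sum_nat_eq0 negb_forall => /existsP[f].
rewrite negb_imply muln_eq0 negb_or => /and3P[fE _].
by rewrite edge_deltaE cmU eqb0 negbK => /eqP <-; exists f, fE.
Qed.

Lemma tree_product_tree_monomial : tree_monomial (tree_product T).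
Proof.
apply/forallP => c; apply/forallP => d; apply/implyP => /tree_product_gt0[f [fE ->]].
by apply/implyP => /tree_product_gt0[g [gE ->]]; apply: edges_noncrossing.
Qed.

(** A lower bound suffices later, so distinct edges need not be shown to have distinct cuts. *)
Lemma edge_tree_product f (fE : f \in edges T) :
  (mult f <= tree_product T (edge_sym fE))%N.
Proof.
rewrite tree_productE (bigD1 f) //= edge_deltaE cmUU muln1.
exact: leq_addr.
Qed.

End TreeMonomial.

(** * The split tree and its contraction onto the original tree *)

Section Split.
Variables (N : finType) (T : ltree N) (v : vertex T) (e : {set vertex T}).
Variables (L : {set N}) (F : {set {set vertex T}}).
Hypotheses (loadedT : is_loaded T) (Lv : L \subset labels v).
Hypothesis Fv : F \subset incident v.
Implicit Types (f g : {set vertex T}) (u w : option (vertex T)).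

Notation T' := (split_tree v e L F).
Notation cut_connect T f := (connect (adj (edges T :\ f))).

Let treeT : is_tree T. Proof. by case: loadedT. Qed.

(** [reattach] expressed end by end: only the end [v] of an edge in [F] moves, namely to v''. The
    map [odflt v] undoes this. *)
Definition lift_end f (x : vertex T) := if (x == v) && (f \in F) then None else Some x.

Lemma lift_endK f : cancel (lift_end f) (odflt v).
Proof. by move=> x; rewrite /lift_end; case: eqVneq => [->|//]; case: ifP. Qed.

Lemma reattachE f : reattach v F f = lift_end f @: f.
Proof.
rewrite /reattach; case: ifP => fF; last first.
  by apply: eq_imset => x; rewrite /lift_end fF andbF.
have /setD1K {3}<- : v \in f.
  by have := subsetP Fv _ fF; rewrite inE => /andP[].
rewrite imsetU1 /lift_end eqxx fF; congr (_ |: _).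
by apply: eq_in_imset => x; rewrite !inE => /andP[/negPf->].
Qed.

Lemma reattachK : cancel (reattach v F) (fun h : {set option (vertex T)} => odflt v @: h).
Proof.
by move=> f; rewrite reattachE -imset_comp (eq_imset _ (lift_endK f)) imset_id.
Qed.

Lemma reattach_pair x y :
  reattach v F [set x; y] = [set lift_end [set x; y] x; lift_end [set x; y] y].
Proof. by rewrite reattachE imset_pair. Qed.

Lemma reattach_None f : (None \in reattach v F f) = (f \in F).
Proof.
rewrite reattachE; apply/imsetP/idP => [[x _]|fF].
  by rewrite /lift_end; case: ifP => // /andP[].
have vf : v \in f by have := subsetP Fv _ fF; rewrite inE => /andP[].
by exists v; rewrite // /lift_end eqxx fF.
Qed.

Lemma reattach_Some f x :
  (Some x \in reattach v F f) = (x \in f) && ~~ ((x == v) && (f \in F)).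
Proof.
rewrite reattachE; apply/imsetP/andP => [[y yf]|[xf /negPf xv]].
  by rewrite /lift_end; case: ifP => // /negbT nyv [->].
by exists x; rewrite // /lift_end xv.
Qed.

(** Contraction sends the new edge to the single vertex [v], while a reattached edge recovers its
    two ends. *)
Lemma reattach_new f : f \in edges T -> reattach v F f != new_edge v.
Proof.
case: treeT => card2 _ _ /card2 f2; apply: contra_eq_neq f2 => fnew.
by rewrite -(reattachK f) fnew /new_edge imset_pair /= setUid cards1.
Qed.

Lemma new_edge_notin : new_edge v \notin reattach v F @: edges T.
Proof. by apply/imsetP => -[f /reattach_new + fnew]; rewrite -fnew eqxx. Qed.

Lemma split_edgesD1 f : f \in edges T ->
  edges T' :\ reattach v F f = new_edge v |: reattach v F @: (edges T :\ f).
Proof.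
move=> fE; rewrite /= -{1}(setD1K fE) imsetU1 setUCA setU1K //.
rewrite !inE (negPf (reattach_new fE)) /=.
by rewrite (mem_imset _ _ (can_inj reattachK)) !inE eqxx.
Qed.

Lemma split_edgesD1_new : edges T' :\ new_edge v = reattach v F @: edges T.
Proof. by rewrite /= setU1K // new_edge_notin. Qed.

Lemma odflt_connect (E : {set {set option (vertex T)}}) u w :
  new_edge v \in E -> odflt v u = odflt v w -> connect (@adj N T' E) u w.
Proof.
move=> newE; case: u w => [x|] [y|] //= => [->|->|<-]; rewrite ?connect0 //.
  exact: connect1.
by apply: connect1; rewrite /adj setUC.
Qed.

(* Contracting the new edge identifies v' and v''. *)
Lemma split_connect (E : {set {set vertex T}}) u w :
  connect (@adj N T' (new_edge v |: reattach v F @: E)) u w =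
  connect (adj E) (odflt v u) (odflt v w).
Proof.
apply/idP/idP.
  move: w; apply: connect_ind => // a b _ ua; rewrite /adj !inE.
  case/orP=> [/eqP ab|/imsetP[g gE ab]].
    have [] : a \in new_edge v /\ b \in new_edge v by rewrite -ab !inE !eqxx orbT.
    rewrite !inE => aV bV; suff -> : odflt v b = odflt v a by [].
    by case/orP: aV bV => /eqP-> /orP[]/eqP->.
  apply: connect_trans ua _; apply: connect1.
  by rewrite /adj -imset_pair ab reattachK.
suff lift y : connect (adj E) (odflt v u) y -> forall w', odflt v w' = y ->
    connect (@adj N T' (new_edge v |: reattach v F @: E)) u w'.
  by move/lift; apply.
move: y; apply: connect_ind => [|a b _ IH ab] {}w wy.
  by apply: odflt_connect; rewrite ?inE ?eqxx.
have gab := reattach_pair a b; set g := [set a; b] in gab.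
apply: (@connect_trans _ _ (lift_end g b)); last first.
  by apply: odflt_connect; rewrite ?lift_endK ?inE ?eqxx.
apply: (@connect_trans _ _ (lift_end g a)); first by apply: IH; rewrite lift_endK.
apply: connect1; rewrite /adj -gab inE; apply/orP; right; exact: imset_f.
Qed.

Lemma split_cut_connect f u w : f \in edges T ->
  cut_connect T' (reattach v F f) u w = cut_connect T f (odflt v u) (odflt v w).
Proof. by move=> fE; rewrite split_edgesD1 // split_connect. Qed.

(** An explicit description of the component of v'' once the new edge is removed; [behindE] confirms
    it. *)
Definition behind u :=
  if u is Some x then [exists f in F, ~~ cut_connect T f v x] else true.

Lemma behind_adj u w :
  adj (edges T' :\ new_edge v) u w -> behind u -> behind w.
Proof.
rewrite split_edgesD1_new /adj => /imsetP[g gE uw].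
have wg : w \in reattach v F g by rewrite -uw !inE eqxx orbT.
have ug : u \in reattach v F g by rewrite -uw !inE eqxx.
case: w uw wg => [y|//] uw; rewrite reattach_Some => /andP[yg yv].
case: u uw ug => [x|] uw; last first.
  (* From v'' one leaves along an edge [g] of [F], and its other end is behind [g]. *)
  rewrite reattach_None => gF _; rewrite gF andbT in yv.
  apply/exists_inP; exists g => //.
  have vg : v \in g by have := subsetP Fv _ gF; rewrite inE => /andP[].
  have [z gvz _] := edge_pair treeT gE vg.
  move: yg; rewrite gvz => /set2P[yv'|->]; first by rewrite yv' eqxx in yv.
  by apply: tree_bridge; rewrite // -gvz.
(* An edge avoiding v'' comes from [g] outside [F], so it differs from [f] and cannot leave the part
   behind [f]. *)
rewrite reattach_Some => /andP[xg xv] /exists_inP[f fF nx].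
have gxy : g = [set x; y] by rewrite -(reattachK g) -uw imset_pair.
have gF : g \notin F by rewrite -reattach_None -uw !inE.
apply/exists_inP; exists f => //; apply: contra nx => vy.
apply: connect_trans vy (connect1 _); rewrite /adj setUC !inE -gxy gE andbT.
by apply: contraNneq gF => ->.
Qed.

Lemma behind_center : ~~ behind (Some v).
Proof. by apply/exists_inP => -[f _]; rewrite connect0. Qed.

Lemma new_edge_bridge : ~~ cut_connect T' (new_edge v) None (Some v).
Proof.
apply/negP => /(@connect_ind _ _ _ behind)H; case/negP: behind_center.
by apply: H => // a b _ ba /behind_adj; apply.
Qed.

Lemma split_edgeP (g : {set vertex T'}) : g \in edges T' ->
  g = new_edge v \/ exists2 f, f \in edges T & g = reattach v F f.
Proof. by case/setU1P => [->|/imsetP[f fE ->]]; [left | right; exists f]. Qed.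

(** Connectedness and the bridge property of old edges transfer through the contraction; the new
    edge is a bridge because [behind] holds at v'' and fails at v'. *)
Lemma split_is_tree : is_tree T'.
Proof.
split.
- move=> g /split_edgeP[->|[f fE ->]]; first by rewrite cards2.
  rewrite reattachE card_imset; last exact: can_inj (lift_endK f).
  by case: treeT => ->.
- move=> u w; have -> : edges T' = new_edge v |: reattach v F @: edges T by [].
  by rewrite split_connect; case: treeT.
apply: bridges_acyclic => u w uwE; case: (split_edgeP uwE) => [uwnew|[f fE uwf]].
  have := new_edge_bridge; rewrite -uwnew.
  have [] : u \in new_edge v /\ w \in new_edge v by rewrite -uwnew !inE !eqxx orbT.
  have uDw : u != w.
    apply: contra_eq_neq uwnew => ->; rewrite setUid.
    by apply/eqP => /(congr1 (fun A : {set _} => #|A|)); rewrite cards1 cards2.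
  rewrite !inE; case/orP=> /eqP eu /orP[]/eqP ew; move: uDw; rewrite eu ew ?eqxx //.
  by move=> _; rewrite connect_adjC.
rewrite uwf split_cut_connect //.
have fuw : f = [set odflt v u; odflt v w].
  by rewrite -(reattachK f) -uwf imset_pair.
by rewrite fuw; apply: tree_bridge; rewrite // -fuw.
Qed.

(** A vertex not reached from v'' is reached from v', and propagating [behind] back along that path
    would give it at v'. *)
Lemma behindE u : behind u = cut_connect T' (new_edge v) None u.
Proof.
have newE : new_edge v \in edges T' by rewrite !inE eqxx.
have cl (x : vertex T') z : cut_connect T' (new_edge v) x z -> behind x -> behind z.
  by move=> xz bx; move: z xz; apply: connect_ind => // a b _ ba /behind_adj; apply.
apply/idP/idP => [bu|]; last by move/cl; apply.
rewrite (cut_connectC split_is_tree) //.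
apply: contra behind_center => vu; apply: cl bu.
by rewrite connect_adjC.
Qed.

Lemma split_label u n : n \in @labels N T' u -> n \in labels (odflt v u).
Proof.
case: u => [x|] /=; last exact: (subsetP Lv).
by case: eqP => // ->; rewrite inE => /andP[].
Qed.

Lemma label_split x n : n \in labels x ->
  exists2 u, odflt v u = x & n \in @labels N T' u.
Proof.
have [->|xDv] := eqVneq x v; last by exists (Some x); rewrite //= (negPf xDv).
by have [nL|nL] := boolP (n \in L); [exists None | exists (Some v)];
  rewrite //= eqxx inE nL.
Qed.

Lemma split_side f u : f \in edges T ->
  @side N T' (reattach v F f) u = side f (odflt v u).
Proof.
move=> fE; apply/setP => n; apply/bigcupP/bigcupP => [[w uw nw]|[x ux]].
  exists (odflt v w); last exact: split_label.
  by rewrite -split_cut_connect.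
by case/label_split => w wx nw; exists w; rewrite // split_cut_connect ?wx.
Qed.

Lemma split_edge_delta f : f \in edges T ->
  @edge_delta N T' (reattach v F f) = edge_delta f.
Proof.
move=> fE; rewrite /edge_delta.
suff -> : @edge_cut N T' (reattach v F f) = edge_cut f by [].
rewrite /edge_cut -[X in _ = _ @: (mem (pred_of_set X))](reattachK f) -imset_comp.
by apply: eq_imset => u; apply: split_side.
Qed.

Lemma side_new_edge :
  @side N T' (new_edge v) None = L :|: \bigcup_(f in F) branch_labels v f.
Proof.
apply/setP => n; apply/bigcupP/setUP => [[u]|[nL|/bigcupP[f fF]]].
- rewrite -behindE; case: u => [x|_ nL]; last by left.
  case/exists_inP => f fF nvx /split_label nx; right; apply/bigcupP; exists f => //.
  by rewrite (mem_branch loadedT (subsetP Fv _ fF) nx).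
- by exists None; rewrite // -behindE.
have [x nx] := label_vertex loadedT n.
rewrite (mem_branch loadedT (subsetP Fv _ fF) nx) => nvx; exists (Some x).
  by rewrite -behindE; apply/exists_inP; exists f.
by rewrite /=; case: eqP nvx => // ->; rewrite connect0.
Qed.

Lemma split_tree_product c : e \in edges T -> (0 < mult e)%N ->
  edge_delta e = U_(c)%M ->
  tree_product T' =
    mmul (divide_delta (tree_product T) c) (@edge_delta N T' (new_edge v)).
Proof.
move=> eE me ec; apply/eqP/cmP => d; rewrite cmM /divide_delta divcmE !tree_productE.
rewrite /= big_setU1 ?new_edge_notin //= eqxx mul1n addnC; congr (_ + _)%N.
rewrite big_imset /=; last by apply: in2W; apply: can_inj reattachK.
rewrite (bigD1 e) //= [in RHS](bigD1 e) //= -ec.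
rewrite (negPf (reattach_new eE)) reattachK eqxx split_edge_delta //.
(* The subtraction is truncated; positivity of [mult e] makes it exact here. *)
rewrite mulnBl mul1n -addnBAC; last by rewrite leq_pmull.
congr (_ + _)%N; apply: eq_bigr => f /andP[fE fDe].
by rewrite (negPf (reattach_new fE)) reattachK (negPf fDe) subn0 split_edge_delta.
Qed.

Lemma split_degree u : @degree N T' u =
  ((u \in new_edge v) + #|[set f in edges T | u \in reattach v F f]|)%N.
Proof.
rewrite /degree /incident -!sum1dep_card !big_mkcondr /=.
rewrite big_setU1 ?new_edge_notin //; congr (_ + _)%N.
by rewrite big_imset //; apply: in2W; apply: can_inj reattachK.
Qed.

(** The bounds are 2 rather than 3 because the new edge adds one to the degree of both v' and
    v''. *)
Lemma split_is_loaded :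
    (forall f, f \in edges T -> (0 < mult f - (f == e))%N) ->
    (2 <= #|incident v :\: F| + #|labels v :\: L|)%N -> (2 <= #|F| + #|L|)%N ->
  is_loaded T'.
Proof.
move=> mult_gt0 lo hi; split; first exact: split_is_tree.
- split.
    move=> u w uDw; rewrite -setI_eq0; apply/set0Pn => -[n] /setIP[nu nw].
    have ouw := label_vertex_uniq loadedT (split_label nu) (split_label nw).
    case: u w uDw ouw nu nw => [x|] [y|] //= uDw ouw.
    + by rewrite ouw eqxx in uDw.
    + by rewrite ouw eqxx inE => /andP[/negPf->].
    + by rewrite -ouw eqxx inE => -> .
  apply/setP => n; rewrite in_setT; have [x nx] := label_vertex loadedT n.
  by have [u _ nu] := label_split nx; apply/bigcupP; exists u.
- move=> g /split_edgeP[->|[f fE ->]] /=; first by rewrite eqxx.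
  by rewrite (negPf (reattach_new fE)) reattachK mult_gt0.
case=> [x|]; rewrite split_degree !inE /=.
  have [->|xDv] := eqVneq x v.
    rewrite eqxx /= add1n addSn ltnS; apply: leq_trans lo _.
    rewrite leq_add2r subset_leq_card //.
    apply/subsetP => f; rewrite !inE reattach_Some eqxx => /and3P[fF fE vf].
    by rewrite fE vf.
  case: loadedT => _ _ _ /(_ x) lx; apply: leq_trans lx _.
  rewrite leq_add2r (leq_trans _ (leq_addl _ _)) // subset_leq_card //.
  by apply/subsetP => f; rewrite !inE reattach_Some (negPf xDv) andbT.
rewrite add1n addSn ltnS; apply: leq_trans hi _; rewrite leq_add2r subset_leq_card //.
apply/subsetP => f fF; rewrite inE reattach_None fF andbT.
by have := subsetP Fv _ fF; rewrite inE => /andP[].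
Qed.

End Split.

(** Multiplication by one monomial turns each coefficient into a count of the summands that yield
    [P]. *)
Lemma mcoeff_mul_sumBB (K : monomType) (R : nzRingType) (I : finType)
    (C D : pred I) (h : I -> K) (m k P : K) :
  (fgmul << m >> (\sum_(i | C i) << h i >> - (\sum_(i | D i) << h i >> - << k >>))
     : {malg R[K]})@_P =
  (\sum_(i | C i) (mmul m (h i) == P))%:R
    - ((\sum_(i | D i) (mmul m (h i) == P))%:R - (mmul m k == P)%:R).
Proof.
rewrite -malgM_def !mulrBr !mcoeffB.
have coefU k' : (<< m >> * << k' >> : {malg R[K]})@_P = (mmul m k' == P)%:R.
  by rewrite malgM_def fgmulUU mulr1 mcoeffU1.
have coef_sum (E : pred I) :
    (<< m >> * \sum_(i | E i) << h i >> : {malg R[K]})@_P =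
    (\sum_(i | E i) (mmul m (h i) == P))%:R.
  by rewrite mulr_sumr raddf_sum natr_sum; apply: eq_bigr => i _; apply: coefU.
by rewrite !coef_sum coefU.
Qed.

(** * The support of one linear reduction step *)

Section Reduction.
Variable N : finType.
Implicit Types (M P : monomial N) (c d : cut N).

Lemma delete_keelE (p : formal_sum N) P :
  (delete_keel p)@_P = if tree_monomial P then p@_P else 0.
Proof.
rewrite /delete_keel raddf_sum /= big_mkcond /=.
under eq_bigr do rewrite mcoeffU.
have other Q : Q != P -> (if tree_monomial Q then p@_Q *+ (Q == P) else 0) = 0.
  by move=> /negPf->; rewrite mulr0n if_same.
have [Pp|Pp] := boolP (P \in msupp p).
  rewrite (bigD1_seq P Pp (fset_uniq _)) /= eqxx mulr1n.
  by rewrite (big1 _ _ _ other) addr0.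
rewrite (mcoeff_outdom Pp) if_same big_seq big1 // => Q Qp.
by apply: other; apply: contraNneq Pp => <-.
Qed.

(* Swapping j and k crosses the cut c, so these cuts only contribute terms
   deleted by Keel's quadratic relation. *)
Lemma keel_separates c d i j k l :
  separates c i j k l -> separates d i k j l -> keel_quadratic c d.
Proof.
move=> /separatesP[A [cA iA jA kA lA]] /separatesP[B [dB iB kB jB lB]].
apply/forall_inP => C; rewrite cA => /set2P[]->;
  apply/forall_inP => D; rewrite dB => /set2P[]->; apply/set0Pn.
- by exists i; rewrite inE iA.
- by exists j; rewrite !inE jA.
- by exists k; rewrite !inE kA.
by exists l; rewrite !inE lA.
Qed.

Lemma tree_monomialN P c d : tree_monomial P -> (0 < P c)%N -> (0 < P d)%N ->
  ~~ keel_quadratic c d.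
Proof. by move=> /forallP/(_ c)/forallP/(_ d)/implyP + Pc => /(_ Pc)/implyP. Qed.

Lemma linear_reduction_msupp M c i j k l P :
    separates c i j k l -> (2 <= M c)%N ->
  P \in msupp (linear_reduction M c i j k l) <->
  tree_monomial P /\ exists d : cut N,
    [/\ separates d i j k l, d != c & P = mmul (divide_delta M c) (U_(d))%M].
Proof.
move=> sepc Mc; rewrite -mcoeff_neq0 /linear_reduction delete_keelE.
have [treeP|] := boolP (tree_monomial P); last by rewrite eqxx; split=> // -[].
rewrite malgM_def /epsilon mcoeff_mul_sumBB.
have : (0 < divide_delta M c c)%N by rewrite divcmE cmU eqxx subn_gt0.
move: (divide_delta M c) => m mc.
(* A summand of the first sum yielding [P] would put two crossing cuts into the tree monomial [P],
   since [c] still divides [m]. *)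
rewrite [X in X - _](_ : _ = 0) ?sub0r ?oppr_eq0; last first.
  rewrite big1 // => d sepd; apply/eqP; rewrite eqb0; apply/eqP => mP.
  have Pc : (0 < P c)%N by rewrite -mP cmM ltn_addr.
  have Pd : (0 < P d)%N by rewrite -mP cmM cmUU addn1.
  by have /negP[] := tree_monomialN treeP Pc Pd; apply: keel_separates sepc sepd.
(* The term of [c] cancels against the subtracted delta. What remains is, up to sign, a natural
   number counting the cuts [d], so it vanishes only if there are none. *)
rewrite (bigD1 c) //= natrD addrC addKr Num.Theory.pnatr_eq0 sum_nat_eq0.
rewrite negb_forall; split=> [/existsP[d]|[_ [d [sepd dDc ->]]]].
  rewrite negb_imply eqb0 negbK => /andP[/andP[sepd dDc] /eqP<-].
  by split=> //; exists d.
by apply/existsP; exists d; rewrite sepd dDc eqxx.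
Qed.
End Reduction.

Lemma separatesC (N : finType) (c : cut N) i j k l :
  separates c i j k l = separates c k l i j.
Proof.
suff sub a b x y : separates c a b x y -> separates c x y a b.
  by apply/idP/idP; apply: sub.
move=> /separatesP[A [cA aA bA xA yA]]; apply/separatesP; exists (~: A).
by rewrite setCK !inE xA yA setUC aA bA.
Qed.

(** * Branches at the vertex to be split *)

Section Branches.
Variables (N : finType) (T : ltree N) (v : vertex T).
Hypothesis loadedT : is_loaded T.
Implicit Types f g : {set vertex T}.

Let treeT : is_tree T. Proof. by case: loadedT. Qed.

(** What lies behind [f] is reached from [v] by crossing [f] and then staying clear of [v], hence
    without using [g]. *)
Lemma branch_disjoint f g : f \in incident v -> g \in incident v -> f != g ->
  [disjoint branch_labels v f & branch_labels v g].
Proof.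
move=> fv gv fDg; rewrite -setI_eq0; apply/set0Pn => -[n]; rewrite inE.
have [u nu] := label_vertex loadedT n.
rewrite (mem_branch loadedT fv nu) (mem_branch loadedT gv nu) => /andP[nfu ngu].
move: fv gv; rewrite !inE => /andP[fE vf] /andP[gE vg].
have [z fvz zDv] := edge_pair treeT fE vf.
have fzv : ~~ connect (adj (edges T :\ f)) z v.
  by rewrite connect_adjC fvz tree_bridge -?fvz.
case/negP: ngu; apply: (@connect_trans _ _ z).
  by apply: connect1; rewrite /adj !inE -fvz fDg.
apply: cut_connect_sub fzv _; rewrite // 1?eq_sym //.
by rewrite fvz cut_connectC -?fvz.
Qed.

(** Along a path from [v], the first edge enters a branch, and every later step stays in it unless
    it returns to [v]. *)
Lemma label_branch n : n \notin labels v ->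
  exists2 f, f \in incident v & n \in branch_labels v f.
Proof.
have [u nu] := label_vertex loadedT n; move=> nv.
have [uv|[f fv vu]] : u = v \/
    exists2 f, f \in incident v & ~~ connect (adj (edges T :\ f)) v u; first last.
- by exists f; rewrite // (mem_branch loadedT fv nu).
- by rewrite uv (negPf nv) in nu.
case: (treeT) => _ conn _; move: u (conn v u) {nu}.
apply: connect_ind; first by left.
move=> a b _ IH; rewrite /adj => abE; have [->|bDv] := eqVneq b v; [by left | right].
have [av|[f fv nva]] := IH.
  exists [set a; b]; first by rewrite inE abE av !inE eqxx.
  by rewrite -av tree_bridge.
have [fab|fDab] := eqVneq [set a; b] f.
  move: (fv); rewrite inE -fab !inE => /andP[_ /orP[]/eqP va].
    by rewrite va connect0 in nva.
  by rewrite va eqxx in bDv.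
exists f; rewrite //; apply: contra nva => vb; apply: connect_trans vb _.
by apply: connect1; rewrite /adj setUC !inE fDab.
Qed.

(** * Splitting one end [v] of the multi-edge [e]; either end can play this role *)

Variables (y : vertex T) (e : {set vertex T}) (c : cut N).
Hypotheses (e_vy : e = [set v; y]) (eE : e \in edges T) (me : (2 <= mult e)%N).
Hypothesis c_e : val c = [set side e v; side e y].

Lemma center_edge : e \in incident v.
Proof. by rewrite inE eE e_vy !inE eqxx. Qed.

Lemma edge_sym_center (fE : e \in edges T) : edge_sym loadedT fE = c.
Proof. by apply: val_inj; rewrite c_e /= /edge_cut [in LHS]e_vy imset_pair -e_vy. Qed.

Lemma edge_delta_center : edge_delta e = U_(c)%M.
Proof. by rewrite (edge_deltaE loadedT eE) edge_sym_center. Qed.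

Lemma branch_center : branch_labels v e = side e y.
Proof. exact: branch_side. Qed.

Lemma side_center : side e v = ~: side e y.
Proof. by rewrite e_vy side_setC ?setCK // -e_vy. Qed.

Lemma tree_product_center : (2 <= tree_product T c)%N.
Proof. by apply: leq_trans me _; rewrite -(edge_sym_center eE) edge_tree_product. Qed.

(** The v'' side [B] of the new edge contains the far side of [e], because [e] is in [F], and avoids
    [a] and [b], whose labels or branches stay at v'. The extra label or branch given to v'' makes
    its cut differ from [c]. *)
Lemma vertex_splitting_sound a b k l T' :
    k \in side e y -> l \in side e y -> vertex_splitting v e a b T' ->
  tree_monomial (tree_product T') /\ exists d : cut N,
    [/\ separates d a b k l, d != c
      & tree_product T' = mmul (divide_delta (tree_product T) c) (U_(d))%M].
Proof.
move=> ky ly [L [F [[_ [Lv dL] [Fv eF aF] _ L0] -> loadedT']]].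
split; first exact: tree_product_tree_monomial.
have newE : new_edge v \in edges (split_tree v e L F) by rewrite !inE eqxx.
exists (edge_sym loadedT' newE); set d := edge_sym _ _.
set B := @side N (split_tree v e L F) (new_edge v) None.
have BE : B = L :|: \bigcup_(f in F) branch_labels v f by apply: side_new_edge.
have dB : val d = [set ~: B; B].
  by rewrite /= /edge_cut imset_pair -[X in [set X; _]]setCK -(side_setC loadedT').
have yB n : n \in side e y -> n \in B.
  by move=> ny; rewrite BE inE; apply/orP; right; apply/bigcupP; exists e;
    rewrite ?branch_center.
have abB n : n \in [set a; b] -> n \notin B.
  move=> nab; rewrite BE inE negb_or (disjointFl dL nab); apply/bigcupP => -[f fF nf].
  have := aF f (subsetP Fv _ fF); rewrite fF => H.
  by case/set2P: nab => nE; move: H; rewrite -nE nf ?orbT => /(_ isT).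
split.
- apply/separatesP; exists (~: B).
  by rewrite setCK dB; split; rewrite // !in_setC ?negbK ?abB ?set21 ?set22 ?yB.
- apply/eqP => dc; have : B \in val c by rewrite -dc dB !inE eqxx orbT.
  rewrite c_e => /set2P[Bv|By].
    by have := yB k ky; rewrite Bv side_center inE ky.
  (* Now [B] would equal the far side of [e], but v'' also carries a label of [v] or a second,
     nonempty branch, both disjoint from that side. *)
  have [L00|/set0Pn[n nL]] := eqVneq L set0.
    have [f fF fDe] := L0 L00; have fv := subsetP Fv _ fF.
    have fB : branch_labels v f \subset B.
      by rewrite BE subsetU // orbC (bigcup_sup f).
    have := branch_disjoint fv center_edge fDe.
    rewrite branch_center -By disjoint_sym => /disjointFl dBf.
    move: fv; rewrite inE => /andP[fE vf].
    have [z fvz _] := edge_pair treeT fE vf.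
    have : (0 < #|side f z|)%N.
      by apply: ltnW; apply: card_side; rewrite // fvz !inE eqxx orbT.
    rewrite -(branch_side loadedT fE fvz) => /card_gt0P[n nf].
    by have := subsetP fB n nf; rewrite dBf.
  have : n \in side e v by rewrite (mem_side loadedT _ _ (subsetP Lv _ nL)) connect0.
  by rewrite side_center inE -By BE inE nL.
rewrite (split_tree_product loadedT Lv Fv eE (ltnW me) edge_delta_center).
by rewrite (edge_deltaE loadedT' newE).
Qed.

Lemma vertex_splitting_complete a b k (d : cut N) (B : {set N}) :
    a != b -> k \in side e y -> apart v a b -> a \notin B -> b \notin B ->
    side e y \proper B -> val d = [set B; ~: B] ->
    tree_monomial (mmul (divide_delta (tree_product T) c) (U_(d))%M) ->
  exists2 T', vertex_splitting v e a b T'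
    & tree_product T' = mmul (divide_delta (tree_product T) c) (U_(d))%M.
Proof.
move=> aDb ky ab_apart aB bB /properP[yB [x xB xy]] dB treeP.
have branch_cases f : f \in incident v ->
    branch_labels v f \subset B \/ branch_labels v f \subset ~: B.
  move=> fv; have [->|fDe] := eqVneq f e; first by left; rewrite branch_center.
  have := branch_disjoint fv center_edge fDe; rewrite branch_center => dfy.
  move: (fv); rewrite inE => /andP[fE vf]; have [z fvz _] := edge_pair treeT fE vf.
  have Pf : (0 < mmul (divide_delta (tree_product T) c) (U_(d))%M
      (edge_sym loadedT fE))%N.
    rewrite cmM ltn_addr // divcmE cmU subn_gt0.
    have [<-|_] := eqVneq; first exact: tree_product_center.
    apply: leq_trans (edge_tree_product loadedT fE).
    by case: loadedT => _ _ ->.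
  have Pd : (0 < mmul (divide_delta (tree_product T) c) (U_(d))%M d)%N.
    by rewrite cmM cmUU addn1.
  have := tree_monomialN treeP Pf Pd; rewrite /keel_quadratic /= dB.
  set X := branch_labels v f.
  have -> : edge_cut f = [set ~: X; X].
    rewrite /edge_cut [in LHS]fvz imset_pair -fvz /X (branch_side loadedT fE fvz).
    by rewrite fvz (side_setC loadedT) ?setCK -?fvz.
  (* Noncrossing leaves four cases. If [B] is inside [X], then [k] would lie in two branches; if the
     complement of [B] is inside [X], one branch would contain both [a] and [b]. The other two are
     the claim. *)
  case/forall_inPn => X' /set2P[]-> /forall_inPn[B' /set2P[]->];
    rewrite negbK setI_eq0 disjoints_subset ?setCK => XB.
  - have := subsetP XB k.
    by rewrite !inE (disjointFl dfy ky) (subsetP yB _ ky) => /(_ isT).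
  - have := ab_apart f fv; rewrite negb_and.
    have BX n : n \notin B -> n \in X.
      by apply: contraR => nX; apply: (subsetP XB); rewrite inE.
    by rewrite !BX.
  - by right.
  - by left.
pose L := labels v :&: B.
pose F := [set f in incident v | branch_labels v f \subset B].
have Lv : L \subset labels v by apply: subsetIl.
have Fv : F \subset incident v by apply/subsetP => f; rewrite inE => /andP[].
have FP f n : f \in incident v -> n \in branch_labels v f -> (f \in F) = (n \in B).
  move=> fv nf; rewrite inE fv /=; case: (branch_cases f fv) => sub.
    by rewrite sub (subsetP sub _ nf).
  have := subsetP sub n nf; rewrite inE => nB; rewrite (negPf nB).
  by apply: contraNF nB => /subsetP; apply.
have eF : e \in F by rewrite (FP e k) ?center_edge ?branch_center ?(subsetP yB).
(* The point [x] of [B] beyond the far side of [e] supplies what v'' receives besides [e]. *)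
have grow : L != set0 \/ exists2 f, f \in F & f != e.
  have [xv|/label_branch[f fv xf]] := boolP (x \in labels v).
    by left; apply/set0Pn; exists x; rewrite inE xv.
  right; exists f; first by rewrite (FP f x).
  by apply: contraNneq xy => fe; rewrite -branch_center -fe.
have hi : (2 <= #|F| + #|L|)%N.
  case: grow => [L0|[f fF fDe]].
    by apply: (@leq_add 1 1); rewrite card_gt0 //; apply/set0Pn; exists e.
  rewrite (leq_trans _ (leq_addr _ _)) //; apply/card_gt1P.
  by exists f, e.
(* The labels [a] and [b] lie outside [B], and by [ab_apart] they account for two distinct labels or
   branches left at v'. *)
have lo : (2 <= #|incident v :\: F| + #|labels v :\: L|)%N.
  have labD n : n \notin B -> n \in labels v -> n \in labels v :\: L.
    by move=> nB nv; rewrite !inE nv (negPf nB).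
  have incD n f : n \notin B -> f \in incident v -> n \in branch_labels v f ->
      f \in incident v :\: F.
    by move=> nB fv nf; rewrite inE (FP f n) // nB.
  have [av|/label_branch[f fv af]] := boolP (a \in labels v);
    have [bv|/label_branch[g gv bg]] := boolP (b \in labels v).
  - rewrite (leq_trans _ (leq_addl _ _)) //; apply/card_gt1P.
    by exists a, b; rewrite !labD.
  - apply: (@leq_add 1 1); apply/card_gt0P; first by exists g; apply: incD bg.
    by exists a; apply: labD.
  - apply: (@leq_add 1 1); apply/card_gt0P; first by exists f; apply: incD af.
    by exists b; apply: labD.
  rewrite (leq_trans _ (leq_addr _ _)) //; apply/card_gt1P; exists f, g.
  split; [exact: incD af | exact: incD bg |].
  by apply: contraNneq (ab_apart f fv) => fg; rewrite af fg bg.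
have mult_gt0 f : f \in edges T -> (0 < mult f - (f == e))%N.
  case: eqVneq => [->|_] fE; rewrite ?subn_gt0 ?subn0 //.
  by case: loadedT => _ _ ->.
have loadedT' : is_loaded (split_tree v e L F).
  exact: split_is_loaded.
have admissible : split_admissible v e a b L F.
  split=> //.
  - rewrite /weight subn_eq0 -ltnNge /degree.
    (* Nonzero weight means at least 4 edges and labels at [v]: two at v'' by [hi] and two at v' by
       [lo]. *)
    rewrite -(cardsID F (incident v)) -(cardsID L (labels v)) (setIidPr Fv) (setIidPr Lv).
    by rewrite addnACA; apply: (@leq_add 2 2).
  - split=> //; rewrite disjoint_sym disjoints_subset; apply/subsetP => n /set2P[]->;
      by rewrite !inE ?(negPf aB) ?(negPf bB) andbF.
  - by split=> // f fv /orP[] nf; rewrite (FP f _ fv nf).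
  - move=> all_ab; case: grow => // -[f fF fDe].
    have fv := subsetP Fv _ fF; have := all_ab f fv; rewrite (negPf fDe) /=.
    by case/orP=> nf; move: fF; rewrite (FP f _ fv nf) ?(negPf aB) ?(negPf bB).
  - by move=> L0; case: grow => //; rewrite L0 eqxx.
exists (split_tree v e L F); first by exists L, F.
rewrite (split_tree_product loadedT Lv Fv eE (ltnW me) edge_delta_center).
have newE : new_edge v \in edges (split_tree v e L F) by rewrite !inE eqxx.
rewrite (edge_deltaE loadedT' newE); congr (mmul _ (ucm _)); apply: val_inj.
have sideB : @side N (split_tree v e L F) (new_edge v) None = B.
  rewrite (side_new_edge _ loadedT Lv Fv); apply/eqP; rewrite eqEsubset.
  apply/andP; split.
    rewrite subUset subsetIr; apply/bigcupsP => f.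
    by rewrite inE => /andP[].
  apply/subsetP => n nB; rewrite !inE nB andbT.
  have [//|/label_branch[f fv nf]] := boolP (n \in labels v).
  by apply/bigcupP; exists f; rewrite // (FP f n).
rewrite dB /= /edge_cut imset_pair -[X in [set X; _]]setCK -(side_setC loadedT') //.
by rewrite sideB setUC.
Qed.

End Branches.

(** * Trees produced by splitting and monomials produced by reduction *)

Theorem theorem4p19 (N : finType) (M : monomial N) (T : ltree N)
    (v1 v2 : vertex T) (c : cut N) (i j k l : N)
    (hN : (3 <= #|N|)%N)
    (M_tree : tree_monomial M) (M_proper : is_proper M) (M_nonclever : is_nonclever M)
    (T_loaded : is_loaded T) (T_M : tree_product T = M)
    (e_edge : [set v1; v2] \in edges T) (e_multi : (2 <= mult [set v1; v2])%N)
    (c_cut : val c = [set side [set v1; v2] v1; side [set v1; v2] v2])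
    (Q_uniq : uniq [:: i; j; k; l])
    (Q_I : (i \in side [set v1; v2] v1) && (j \in side [set v1; v2] v1))
    (Q_J : (k \in side [set v1; v2] v2) && (l \in side [set v1; v2] v2)) :
  forall P : monomial N,
    [/\ (exists2 T', reduction_output v1 v2 i j k l T' & tree_product T' = P) ->
          P \in msupp (linear_reduction M c i j k l),
        apart v1 i j -> apart v2 k l ->
          P \in msupp (linear_reduction M c i j k l) ->
          exists2 T', reduction_output v1 v2 i j k l T' & tree_product T' = P
      & P \in msupp (linear_reduction M c i j k l) <->
          tree_monomial P /\
          exists d : cut N, [/\ separates d i j k l, d != c
            & P = mmul (divide_delta M c) (U_(d))%M]].
Proof.
move=> P; set e := [set v1; v2] in e_edge e_multi c_cut Q_I Q_J *.
(* The same edge and cut with the ends swapped, for splitting at [v2]. *)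
have e21 : e = [set v2; v1] by rewrite /e setUC.
have c21 : val c = [set side e v2; side e v1] by rewrite c_cut setUC.
case/andP: Q_I => iI jI; case/andP: Q_J => kJ lJ.
have IJ : side e v1 = ~: side e v2 := side_center T_loaded (erefl e) e_edge.
have sep_c : separates c i j k l.
  apply/separatesP; exists (side e v1).
  by rewrite c_cut IJ setCK in iI jI *; split; rewrite // inE ?negbK.
have Mc : (2 <= M c)%N.
  by rewrite -T_M; apply: (tree_product_center T_loaded (erefl e)).
have msuppP Q := linear_reduction_msupp Q sep_c Mc.
have weightN v a b T' : vertex_splitting v e a b T' -> weight v <> 0%N.
  by case=> L [F [[/eqP]]].
split=> [[T' [_ splitT'] <-]|ap1 ap2 /msuppP[treeP [d [sepd dDc PE]]]|];
  last exact: msuppP.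
  apply/msuppP; rewrite -T_M; case: splitT' => splitT'.
    exact: (vertex_splitting_sound T_loaded (erefl e) e_edge e_multi c_cut kJ lJ splitT').
  have [treeP [d [sepd dDc PE]]] :=
    vertex_splitting_sound T_loaded e21 e_edge e_multi c21 iI jI splitT'.
  by split=> //; exists d; split; rewrite // separatesC.
move: Q_uniq; rewrite /= !inE !negb_or andbT.
case/and3P=> [/and3P[iDj _ _] _ kDl].
have [A [dA iA jA kA lA]] := separatesP _ _ _ _ _ sepd.
have Pc : (0 < P c)%N by rewrite PE cmM ltn_addr // divcmE cmUU subn_gt0.
have Pd : (0 < P d)%N by rewrite PE cmM cmUU addn1.
have := tree_monomialN treeP Pc Pd; rewrite /keel_quadratic c_cut dA.
rewrite PE -T_M in treeP *.
(* Since [d] differs from [c], the inclusions found below are proper. *)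
have AI : A != side e v1.
  by apply: contraNneq dDc => AI; apply/eqP/val_inj; rewrite dA c_cut AI {2}IJ setCK.
(* Two of the four disjointness cases are refuted by [i] and [k]. The part of [c] at [v1] inside [A]
   leads to a split at [v2]; the part at [v2] inside the complement of [A] leads to a split at
   [v1]. *)
case/forall_inPn => X /set2P[]-> /forall_inPn[Y /set2P[]->]; rewrite negbK => XY.
- by case/set0Pn: XY; exists i; rewrite inE iI.
- have IA : side e v1 \proper A.
    rewrite properEneq eq_sym AI.
    by rewrite setI_eq0 disjoints_subset setCK in XY.
  have [T' splitT' T'P] := vertex_splitting_complete T_loaded e21 e_edge e_multi c21
    kDl iI ap2 kA lA IA dA treeP.
  by exists T' => //; split; [case=> _; apply: weightN splitT' | right].
- have JA : side e v2 \proper ~: A.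
    rewrite properEneq -disjoints_subset -setI_eq0 XY andbT.
    by apply: contra_neq AI => JA; rewrite IJ JA setCK.
  have dA' : val d = [set ~: A; ~: ~: A] by rewrite dA setCK setUC.
  have iA' : i \notin ~: A by rewrite inE iA.
  have jA' : j \notin ~: A by rewrite inE jA.
  have [T' splitT' T'P] := vertex_splitting_complete T_loaded (erefl e) e_edge
    e_multi c_cut iDj kJ ap1 iA' jA' JA dA' treeP.
  by exists T' => //; split; [case=> + _; apply: weightN splitT' | left].
by case/set0Pn: XY; exists k; rewrite !inE kJ.
Qed.
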